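(* Let $L$ be a logic on the propositional language $\mathcal{L}$ with class of models $\Omega_L$, and suppose that for all $\varphi,\psi\in\mathcal{L}$ and all $v\in\Omega_L$: - if $\vdash_L\varphi$ then $v\not\models_L\neg\varphi$; - $v\models_L\varphi\leftrightarrow\psi$ iff ($v\models_L\neg\varphi\Leftrightarrow v\models_L\neg\psi$); - $v\models_L\neg(\varphi\wedge\psi)$ iff $v\models_L\neg\varphi$ or $v\models_L\neg\psi$. Then for every $L$-possibility distribution $\pi:\Omega_L\to[0,1]$, the mapping $f_2(\pi):\mathcal{L}\to[0,1]$ defined by $f_2(\pi)(\varphi)=1-\sup\{\pi(v): v\models_L\neg\varphi\}$ is an $L$-necessity function.
   Context: $\mathcal{L}$ is a classical propositional language, built from a list of propositional variables and the connectives $\neg,\wedge,\vee,\to,\leftrightarrow$. A logic $L$ on $\mathcal{L}$ is given by a (possibly non-classical) consequence relation $\vdash_L$; $\vdash_L\varphi$ means that $\varphi$ is a theorem of $L$. $\vdash_L\varphi\leftrightarrow\psi$ is a shorthand for ''$\vdash_L\varphi\to\psi$ and $\vdash_L\psi\to\varphi$''; likewise $v\models_L\varphi\leftrightarrow\psi$ stands for ''$v\models_L\varphi\to\psi$ and $v\models_L\psi\to\varphi$''. $\Omega_L$ is the class of $L$-models and $v\models_L\varphi$ means that $v\in\Omega_L$ satisfies $\varphi$. An $L$-possibility distribution is a mapping $\pi:\Omega_L\to[0,1]$. Convention: $\sup\emptyset=0$. An $L$-necessity function is a mapping $N:\mathcal{L}\to[0,1]$ such that for all $\varphi,\psi$: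 (Taut) if $\vdash_L\varphi$ then $N(\varphi)=1$; (Eq) if $\vdash_L\varphi\leftrightarrow\psi$ then $N(\varphi)=N(\psi)$; (Conj) $N(\varphi\wedge\psi)=\min(N(\varphi),N(\psi))$.
   Formalization: The L-models are assumed to be sound for theorems of L: if ⊢_L φ then v ⊨_L φ for every v in Ω_L; without this link between ⊢_L and ⊨_L, property (Eq) can fail. *)

(* Defs.v *)
From mathcomp Require Import all_boot all_order all_algebra.
From mathcomp Require Import classical_sets reals.
Set Implicit Arguments.
Unset Strict Implicit.
Unset Printing Implicit Defensive.
Import Order.TTheory GRing.Theory Num.Theory.
Local Open Scope classical_set_scope.
Local Open Scope ring_scope.

Inductive formula (A : Type) : Type :=
| Var of A
| Neg of formula A
| And of formula A & formula A
| Or of formula A & formula A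
| Imp of formula A & formula A
| Iff of formula A & formula A.

(* No structural property (monotonicity, cut, ...) is imposed on the
   consequence relation, and satisfaction need not be truth-functional.  The
   only link between the two is what makes the elements of [model] models of
   the logic: they satisfy its theorems, i.e. the consequences of the empty
   set of premises. *)
Record logic (A : Type) := Logic {
  entails : set (formula A) -> formula A -> Prop;
  model : Type;
  sat : model -> formula A -> Prop;
  model_sat : forall (v : model) (phi : formula A),
    entails set0 phi -> sat v phi
}.

Definition provable (A : Type) (L : logic A) (phi : formula A) : Prop :=
  entails L set0 phi.

(* Derivability and satisfaction of an equivalence are those of the two
   implications; the connective [Iff] itself plays no role in them. *)
Definition provable_equiv (A : Type) (L : logic A) (phi psi : formula A) :=
  provable L (Imp phi psi) /\ provable L (Imp psi phi).

Definition sat_equiv (A : Type) (L : logic A) (v : model L)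
    (phi psi : formula A) :=
  sat v (Imp phi psi) /\ sat v (Imp psi phi).

Definition possibility_distribution (R : realType) (A : Type) (L : logic A)
    (p : model L -> R) : Prop :=
  forall v : model L, 0 <= p v <= 1.

Record necessity_function (R : realType) (A : Type) (L : logic A)
    (N : formula A -> R) : Prop := NecessityFunction {
  necessity_range : forall phi, 0 <= N phi <= 1;
  necessity_taut : forall phi, provable L phi -> N phi = 1;
  necessity_eq : forall phi psi, provable_equiv L phi psi -> N phi = N psi;
  necessity_conj : forall phi psi, N (And phi psi) = Num.min (N phi) (N psi)
}.

(* The library's [sup set0] is [0] (lemma [sup0]), which is the intended
   value when no model satisfies [Neg phi]. *)
Definition f2 (R : realType) (A : Type) (L : logic A) (p : model L -> R)
    (phi : formula A) : R :=
  1 - sup [set p v | v in [set v : model L | sat v (Neg phi)]].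

(* Main.v *)
(* Write Q(phi) for sup {p v | v |= ~phi}, so that f2 p = 1 - Q.  The three
   hypotheses say that the set of models refuting phi is empty for a theorem,
   depends only on phi up to provable equivalence, and turns conjunctions into
   unions.  As the values of p are nonnegative, the convention that the empty
   set has supremum 0 makes the supremum of a union the maximum of the suprema
   even if one of the sets is empty, and 1 - max a b = min (1 - a) (1 - b). *)
Require Import Defs.
From mathcomp Require Import all_boot all_order all_algebra.
From mathcomp Require Import classical_sets reals.
Import Order.TTheory GRing.Theory Num.Theory.
Local Open Scope classical_set_scope.
Local Open Scope ring_scope.

(* The bound [c] is nonnegative because [sup set0 = 0]. *)
Lemma ge_sup0P (R : realType) (S : set R) (c : R) :
  has_ubound S -> 0 <= c -> sup S <= c <-> ubound S c.
Proof.
move=> Sub c0; split=> [Sc x Sx|Sc]; first exact: le_trans (ub_le_sup Sub Sx) Sc.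
have [->|S0] := eqVneq S set0; first by rewrite sup0.
by apply: ge_sup => //; apply/set0P.
Qed.

Lemma sup_ge0_of_ge0 (R : realType) (S : set R) :
  has_ubound S -> lbound S 0 -> 0 <= sup S.
Proof.
move=> Sub S0; have [->|/set0P[x Sx]] := eqVneq S set0; first by rewrite sup0.
exact: le_trans (S0 x Sx) (ub_le_sup Sub Sx).
Qed.

(** The upper bounds of a union are the common upper bounds of its parts. Without nonnegativity this
    fails: for [S] empty and [T] negative the maximum would be 0. *)
Lemma sup_setU_max (R : realType) (S T : set R) :
  has_ubound S -> has_ubound T -> lbound S 0 -> lbound T 0 ->
  sup (S `|` T) = Num.max (sup S) (sup T).
Proof.
move=> Sub Tub S0 T0.
have ubU c : ubound (S `|` T) c <-> ubound S c /\ ubound T c.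
  split=> [h|[hS hT] x [/hS|/hT]] //.
  by split=> x hx; apply: h; [left|right].
have max_ub : ubound (S `|` T) (Num.max (sup S) (sup T)).
  by apply/ubU; split=> x /ub_le_sup hx; rewrite le_max hx ?orbT.
have Uub : has_ubound (S `|` T) by exists (Num.max (sup S) (sup T)).
have U0 : 0 <= sup (S `|` T).
  by apply: sup_ge0_of_ge0 => // x [/S0|/T0].
(* [U0] lets [sup] of the union serve as the bound in [ge_sup0P], so it bounds each part. *)
have [hS hT] := (ubU _).1 ((ge_sup0P _ _ _ Uub U0).1 (lexx _)).
apply/le_anti/andP; split.
  by apply/ge_sup0P => //; rewrite le_max sup_ge0_of_ge0.
by rewrite ge_max; apply/andP; split; apply/ge_sup0P.
Qed.

Theorem proposition13 (R : realType) (A : Type) (L : logic A)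
  (theorem_not_refuted : forall (phi : formula A) (v : model L),
     provable L phi -> ~ sat v (Neg phi))
  (equiv_neg : forall (phi psi : formula A) (v : model L),
     sat_equiv v phi psi <-> (sat v (Neg phi) <-> sat v (Neg psi)))
  (neg_and : forall (phi psi : formula A) (v : model L),
     sat v (Neg (And phi psi)) <-> sat v (Neg phi) \/ sat v (Neg psi))
  (p : model L -> R) (hp : possibility_distribution p) :
  necessity_function L (f2 p).
Proof.
have ub1 (V : set (model L)) : ubound (p @` V) 1.
  by move=> _ [v _ <-]; case/andP: (hp v).
have lb0 (V : set (model L)) : lbound (p @` V) 0.
  by move=> _ [v _ <-]; case/andP: (hp v).
have hub (V : set (model L)) : has_ubound (p @` V) by exists 1.
split=> [phi|phi th|phi psi [th1 th2]|phi psi]; rewrite /f2.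
- rewrite subr_ge0 lerBlDr lerDl sup_ge0_of_ge0 // andbT.
  by apply/ge_sup0P.
- rewrite (_ : [set v | _] = set0) ?image_set0 ?sup0 ?subr0 //.
  by apply/seteqP; split=> // v; exact: theorem_not_refuted th.
- congr (1 - sup (p @` _)); apply/seteqP.
  (* Models satisfy theorems, so each one satisfies both implications. *)
  have e (v : model L) : sat v (Neg phi) <-> sat v (Neg psi).
    by apply/equiv_neg; split; exact: model_sat.
  by split=> v /e.
- rewrite (_ : [set v | sat v (Neg (And phi psi))] =
               [set v | sat v (Neg phi)] `|` [set v | sat v (Neg psi)]).
    by rewrite image_setU sup_setU_max // oppr_max addr_minr.
  by apply/seteqP; split=> v /neg_and.
Qed.
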